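(* Let $\mathcal{A}$ be an abelian category and let $a,b$ be positive integers. Let $X\in\mathcal{A}$ be a non-projective object and let $P\in\mathrm{Com}_{a+b}(\mathcal{A})$ be an $\mathrm{H}^{(a,b)}$-projective resolution of $X$. Then $P\notin\mathrm{Com}_{a+b-1}(\mathcal{A})$.
   Context: For $N\ge 1$, $\mathrm{Com}_N(\mathcal{A})$ is the category of $N$-complexes: families $C=(C_i)_{i\in\mathbb{Z}}$ of objects of $\mathcal{A}$ with morphisms $d_i:C_i\to C_{i+1}$ satisfying $d_{i+N-1}\cdots d_{i+1}d_i=0$ for all $i$ (written $d^N=0$); morphisms are families $f_i:C_i\to D_i$ commuting with the differentials. For an $(a+b)$-complex $C$ and $j\in\mathbb{Z}$, $\mathrm{H}^{(a,b)}_j(C)=\ker(d^a:C_j\to C_{j+a})/\operatorname{im}(d^b:C_{j-b}\to C_j)$. A morphism $f$ of $(a+b)$-complexes is an $\mathrm{H}^{(a,b)}$-quasi-isomorphism if $\mathrm{H}^{(a,b)}_j(f)$ is an isomorphism for all $j\in\mathbb{Z}$. An object $P\in\mathrm{Com}_{a+b}(\mathcal{A})$ is an $\mathrm{H}^{(a,b)}$-projective resolution of $X\in\mathcal{A}$ if $P_i=0$ for $i\ge 1$, $P_i$ is projective in $\mathcal{A}$ for $i\le 0$, and there is an $\mathrm{H}^{(a,b)}$-quasi-isomorphism from $P$ to the complex having $X$ in degree $0$ and $0$ in all other degrees. *)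

(* Defs.v *)
From HB Require Import structures.
From mathcomp Require Import all_boot all_order all_algebra.
Set Implicit Arguments.
Unset Strict Implicit.
Unset Printing Implicit Defensive.
Import GRing.Theory.
Local Open Scope ring_scope.

Declare Scope cat_scope.
Delimit Scope cat_scope with cat.
Local Open Scope cat_scope.
Reserved Notation "g ∘ f" (at level 40, left associativity).

(** * Abelian categories *)

HB.mixin Record isPreadditive (C : Type) := {
  hom : C -> C -> zmodType;
  idm : forall X : C, hom X X;
  comp : forall {X Y Z : C}, hom Y Z -> hom X Y -> hom X Z;
  comp1m : forall (X Y : C) (f : hom X Y), comp (idm Y) f = f;
  compm1 : forall (X Y : C) (f : hom X Y), comp f (idm X) = f;
  compA : forall (X Y Z T : C) (h : hom Z T) (g : hom Y Z) (f : hom X Y),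
    comp h (comp g f) = comp (comp h g) f;
  compDl : forall (X Y Z : C) (g1 g2 : hom Y Z) (f : hom X Y),
    comp (g1 + g2) f = comp g1 f + comp g2 f;
  compDr : forall (X Y Z : C) (g : hom Y Z) (f1 f2 : hom X Y),
    comp g (f1 + f2) = comp g f1 + comp g f2
}.

#[short(type="preadditiveCat")]
HB.structure Definition Preadditive := {C of isPreadditive C}.

Arguments comp {s X Y Z}.
Notation "g ∘ f" := (comp g f) : cat_scope.

Section PreadditiveTheory.
Variable A : preadditiveCat.
Implicit Types X Y Z : A.

Definition mono X Y (m : hom X Y) : Prop :=
  forall (T : A) (u v : hom T X), m ∘ u = m ∘ v -> u = v.

Definition epi X Y (e : hom X Y) : Prop :=
  forall (T : A) (u v : hom Y T), u ∘ e = v ∘ e -> u = v.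

Definition iso X Y (f : hom X Y) : Prop :=
  exists g : hom Y X, g ∘ f = idm X /\ f ∘ g = idm Y.

Definition is_zero X : Prop :=
  (forall (T : A) (f : hom X T), f = 0) /\ (forall (T : A) (f : hom T X), f = 0).

Definition is_kernel X Y (f : hom X Y) K (k : hom K X) : Prop :=
  f ∘ k = 0 /\
  forall (T : A) (t : hom T X), f ∘ t = 0 -> exists! u : hom T K, k ∘ u = t.

Definition is_cokernel X Y (f : hom X Y) Q (q : hom Y Q) : Prop :=
  q ∘ f = 0 /\
  forall (T : A) (t : hom Y T), t ∘ f = 0 -> exists! u : hom Q T, u ∘ q = t.

Definition is_biproduct X Y S (i1 : hom X S) (i2 : hom Y S)
    (p1 : hom S X) (p2 : hom S Y) : Prop :=
  [/\ p1 ∘ i1 = idm X, p2 ∘ i2 = idm Y, p1 ∘ i2 = 0, p2 ∘ i1 = 0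
    & i1 ∘ p1 + i2 ∘ p2 = idm S].

Definition projective X : Prop :=
  forall (M N : A) (e : hom M N), epi e ->
  forall f : hom X N, exists g : hom X M, e ∘ g = f.

Lemma comp0m X Y Z (f : hom X Y) : (0 : hom Y Z) ∘ f = 0.
Proof. by apply: (addrI (0 ∘ f)); rewrite -compDl !addr0. Qed.

Lemma compm0 X Y Z (g : hom Y Z) : g ∘ (0 : hom X Y) = 0.
Proof. by apply: (addrI (g ∘ 0)); rewrite -compDr !addr0. Qed.

End PreadditiveTheory.

(* The zero object, kernels and cokernels are chosen, so that complexes
   concentrated in one degree and homology are actual objects. *)
HB.mixin Record isAbelian (C : Type) of Preadditive C := {
  zob : C;
  zobP : is_zero zob;
  biproductP : forall X Y : C, exists (S : C) (i1 : hom X S) (i2 : hom Y S)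
    (p1 : hom S X) (p2 : hom S Y), is_biproduct i1 i2 p1 p2;
  kob : forall {X Y : C}, hom X Y -> C;
  ker : forall {X Y : C} (f : hom X Y), hom (kob f) X;
  kerP : forall (X Y : C) (f : hom X Y), is_kernel f (ker f);
  cob : forall {X Y : C}, hom X Y -> C;
  coker : forall {X Y : C} (f : hom X Y), hom Y (cob f);
  cokerP : forall (X Y : C) (f : hom X Y), is_cokernel f (coker f);
  mono_normal : forall (X Y : C) (m : hom X Y), mono m ->
    exists (Z : C) (g : hom Y Z), is_kernel g m;
  epi_normal : forall (X Y : C) (e : hom X Y), epi e ->
    exists (Z : C) (g : hom Z X), is_cokernel g e
}.

#[short(type="abelianCat")]
HB.structure Definition Abelian := {C of isAbelian C & isPreadditive C}.

Arguments kob {s X Y}.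
Arguments ker {s X Y}.
Arguments kerP {s X Y}.
Arguments cob {s X Y}.
Arguments coker {s X Y}.
Arguments cokerP {s X Y}.

(** * The subquotient ker g / im f *)

Section Homology.
Variable A : abelianCat.
Implicit Types X Y Z T : A.

Lemma ker_lift_ex X Y (f : hom X Y) T (t : hom T X) :
  f ∘ t = 0 -> exists u : hom T (kob f), ker f ∘ u == t.
Proof. by move=> /((kerP f).2 T t) [u [ut _]]; exists u; apply/eqP. Qed.

Definition ker_lift X Y (f : hom X Y) T (t : hom T X) (ft : f ∘ t = 0) :
  hom T (kob f) := xchoose (ker_lift_ex ft).

Lemma ker_liftK X Y (f : hom X Y) T (t : hom T X) (ft : f ∘ t = 0) :
  ker f ∘ ker_lift ft = t.
Proof. exact/eqP/(xchooseP (ker_lift_ex ft)). Qed.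

Lemma coker_desc_ex X Y (f : hom X Y) T (t : hom Y T) :
  t ∘ f = 0 -> exists u : hom (cob f) T, u ∘ coker f == t.
Proof. by move=> /((cokerP f).2 T t) [u [ut _]]; exists u; apply/eqP. Qed.

Definition coker_desc X Y (f : hom X Y) T (t : hom Y T) (tf : t ∘ f = 0) :
  hom (cob f) T := xchoose (coker_desc_ex tf).

Lemma coker_descK X Y (f : hom X Y) T (t : hom Y T) (tf : t ∘ f = 0) :
  coker_desc tf ∘ coker f = t.
Proof. exact/eqP/(xchooseP (coker_desc_ex tf)). Qed.

Lemma ker_mono X Y (f : hom X Y) : mono (ker f).
Proof.
move=> T u v uv; have [fk /(_ T (ker f ∘ u))] := kerP f.
rewrite compA fk comp0m => /(_ erefl) [w [_ wu]].
by rewrite -(wu u) // -(wu v).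
Qed.

Lemma coker_epi X Y (f : hom X Y) : epi (coker f).
Proof.
move=> T u v uv; have [fk /(_ T (u ∘ coker f))] := cokerP f.
rewrite -compA fk compm0 => /(_ erefl) [w [_ wu]].
by rewrite -(wu u) // -(wu v).
Qed.

Definition iob X Y (f : hom X Y) : A := kob (coker f).
Definition im X Y (f : hom X Y) : hom (iob f) Y := ker (coker f).

Lemma comp_im X Y Z (f : hom X Y) (g : hom Y Z) : g ∘ f = 0 -> g ∘ im f = 0.
Proof.
move=> gf; rewrite -(coker_descK gf) -compA /im.
by rewrite (kerP (coker f)).1 compm0.
Qed.

Definition im_ker X Y Z (f : hom X Y) (g : hom Y Z) (gf : g ∘ f = 0) :
  hom (iob f) (kob g) := ker_lift (comp_im gf).

(* [ker g / im f], for [g ∘ f = 0]. *)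
Definition hob X Y Z (f : hom X Y) (g : hom Y Z) (gf : g ∘ f = 0) : A :=
  cob (im_ker gf).

Section Map.
Variables (X Y Z X' Y' Z' : A).
Variables (f : hom X Y) (g : hom Y Z) (gf : g ∘ f = 0).
Variables (f' : hom X' Y') (g' : hom Y' Z') (gf' : g' ∘ f' = 0).
Variables (x : hom X X') (y : hom Y Y') (z : hom Z Z').
Hypotheses (sqf : y ∘ f = f' ∘ x) (sqg : z ∘ g = g' ∘ y).

Lemma ker_map_subproof : g' ∘ (y ∘ ker g) = 0.
Proof. by rewrite compA -sqg -compA (kerP g).1 compm0. Qed.

Definition ker_map : hom (kob g) (kob g') := ker_lift ker_map_subproof.

Lemma im_map_subproof : coker f' ∘ (y ∘ im f) = 0.
Proof.
rewrite compA; apply: comp_im.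
by rewrite -compA sqf compA (cokerP f').1 comp0m.
Qed.

Definition im_map : hom (iob f) (iob f') := ker_lift im_map_subproof.

Lemma im_ker_map : ker_map ∘ im_ker gf = im_ker gf' ∘ im_map.
Proof.
apply: ker_mono; rewrite !compA (ker_liftK ker_map_subproof).
rewrite (ker_liftK (comp_im gf')) -compA (ker_liftK (comp_im gf)).
by rewrite (ker_liftK im_map_subproof).
Qed.

Lemma hmap_subproof : (coker (im_ker gf') ∘ ker_map) ∘ im_ker gf = 0.
Proof. by rewrite -compA im_ker_map compA (cokerP _).1 comp0m. Qed.

Definition hmap : hom (hob gf) (hob gf') := coker_desc hmap_subproof.

End Map.
End Homology.

(** * N-complexes *)

Section Sequences.
Variable A : abelianCat.

Record zseq := ZSeq {
  zseq_ob :> int -> A;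
  zseq_d : forall i : int, hom (zseq_ob i) (zseq_ob (i + 1)) }.

(* Transport of the codomain along an equality of degrees; needed because the
   degrees [i + n + 1] and [i + n.+1], or [j - n + n] and [j], agree only
   propositionally. *)
Definition castc (C : int -> A) (X : A) (i j : int) (e : i = j)
  (f : hom X (C i)) : hom X (C j) := ecast k (hom X (C k)) e f.

Lemma addzS (i : int) (n : nat) : i + n%:Z + 1 = i + n.+1%:Z.
Proof. by rewrite -addrA -PoszD addn1. Qed.

(* The composite [d_(i+n-1) ... d_(i+1) d_i]. *)
Fixpoint dpow (C : zseq) (n : nat) (i : int) : hom (C i) (C (i + n%:Z)) :=
  match n with
  | 0%N => castc (esym (addr0 i)) (idm (C i))
  | m.+1 => castc (addzS i m) (zseq_d C (i + m%:Z) ∘ dpow C m i)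
  end.

Definition dpow_to (C : zseq) (n : nat) (j : int) : hom (C (j - n%:Z)) (C j) :=
  castc (subrK n%:Z j) (dpow C n (j - n%:Z)).

Definition is_Ncomplex (N : nat) (C : zseq) : Prop :=
  forall i : int, dpow C N i = 0.

Record Ncomplex (N : nat) := NComplex {
  Ncomplex_seq :> zseq;
  NcomplexP : is_Ncomplex N Ncomplex_seq }.

Record zseq_hom (C D : zseq) := ZSeqHom {
  zseq_map :> forall i : int, hom (C i) (D i);
  zseq_mapP : forall i : int,
    zseq_map (i + 1) ∘ zseq_d C i = zseq_d D i ∘ zseq_map i }.

Lemma castc_eq (C : int -> A) X (i j : int) (e1 e2 : i = j) (f : hom X (C i)) :
  castc e1 f = castc e2 f.
Proof. by rewrite (eq_irrelevance e1 e2). Qed.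

Lemma castc_id (C : int -> A) X (i : int) (e : i = i) (f : hom X (C i)) :
  castc e f = f.
Proof. by rewrite (eq_irrelevance e erefl). Qed.

Lemma castc0 (C : int -> A) X (i j : int) (e : i = j) :
  castc e (0 : hom X (C i)) = 0.
Proof. by case: j / e. Qed.

Lemma castc_trans (C : int -> A) X (i j k : int) (e1 : i = j) (e2 : j = k)
  (f : hom X (C i)) : castc e2 (castc e1 f) = castc (etrans e1 e2) f.
Proof. by case: k / e2; case: j / e1. Qed.

Lemma castc_comp (C : int -> A) X Y (i j : int) (e : i = j)
  (g : hom Y (C i)) (f : hom X Y) : castc e g ∘ f = castc e (g ∘ f).
Proof. by case: j / e. Qed.

Lemma d_castc (C : zseq) X (i j : int) (e : i = j) (f : hom X (C i)) :
  zseq_d C j ∘ castc e f =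
  castc (congr1 (fun k => k + 1) e) (zseq_d C i ∘ f).
Proof. by case: j / e. Qed.

Lemma castc_nat (C D : int -> A) (u : forall i, hom (C i) (D i)) X (i j : int)
  (e : i = j) (f : hom X (C i)) : u j ∘ castc e f = castc e (u i ∘ f).
Proof. by case: j / e. Qed.

Lemma dpow_add (C : zseq) (m n : nat) (i j : int) (e : i + n%:Z = j)
  (e' : i + (m + n)%N%:Z = j + m%:Z) :
  dpow C m j ∘ castc e (dpow C n i) = castc e' (dpow C (m + n) i).
Proof.
elim: m e' => [|m IHm] e' /=.
  rewrite castc_comp comp1m castc_trans; exact: castc_eq.
have e1 : i + (m + n)%N%:Z = j + m%:Z by rewrite -e addnC PoszD addrA.
rewrite castc_comp -compA (IHm e1) d_castc !castc_trans.
exact: castc_eq.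
Qed.

Lemma dpow_zero (a b : nat) (C : Ncomplex (a + b)) (j : int) :
  dpow C a j ∘ dpow_to C b j = 0.
Proof.
have e' : j - b%:Z + (a + b)%N%:Z = j + a%:Z.
  by rewrite addnC PoszD addrA subrK.
by rewrite /dpow_to (dpow_add C _ e') (NcomplexP C) castc0.
Qed.

Lemma dpow_nat (C D : zseq) (f : zseq_hom C D) (n : nat) (i : int) :
  f (i + n%:Z) ∘ dpow C n i = dpow D n i ∘ f i.
Proof.
elim: n => [|n IHn] /=; first by rewrite castc_nat castc_comp compm1 comp1m.
by rewrite castc_nat castc_comp compA zseq_mapP -!compA IHn.
Qed.

Lemma dpow_to_nat (C D : zseq) (f : zseq_hom C D) (n : nat) (j : int) :
  f j ∘ dpow_to C n j = dpow_to D n j ∘ f (j - n%:Z).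
Proof. by rewrite castc_nat castc_comp dpow_nat. Qed.

Definition homology (a b : nat) (j : int) (C : Ncomplex (a + b)) : A :=
  hob (dpow_zero C j).

Definition homology_map (a b : nat) (j : int) (C D : Ncomplex (a + b))
    (f : zseq_hom C D) : hom (homology j C) (homology j D) :=
  hmap (dpow_zero C j) (dpow_zero D j) (dpow_to_nat f b j) (dpow_nat f a j).

Definition H_quasi_iso (a b : nat) (C D : Ncomplex (a + b))
    (f : zseq_hom C D) : Prop :=
  forall j : int, iso (homology_map j f).

Definition stalk_seq (X : A) : zseq :=
  @ZSeq (fun i => if i == 0 then X else zob) (fun i => 0).

Lemma stalk_subproof (N : nat) (X : A) : (0 < N)%N ->
  is_Ncomplex N (stalk_seq X).
Proof. by case: N => // N _ i /=; rewrite comp0m castc0. Qed.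

Definition stalk (N : nat) (N_gt0 : (0 < N)%N) (X : A) : Ncomplex N :=
  NComplex (stalk_subproof X N_gt0).

Definition H_projective_resolution (a b : nat) (a_gt0 : (0 < a)%N) (X : A)
    (P : Ncomplex (a + b)) : Prop :=
  [/\ forall i : int, 1 <= i -> is_zero (P i),
      forall i : int, i <= 0 -> projective (P i)
    & exists f : zseq_hom P (stalk (ltn_addr b a_gt0) X), H_quasi_iso f].

End Sequences.

(* Main.v *)
Require Import Defs.
From mathcomp Require Import all_boot all_order all_algebra.
From mathcomp Require Import zify.

(** Suppose [d^(a+b-1) = 0] on [P].  Since [P] vanishes in positive degrees,
  [H_j(P) = coker (d^b : P_(j-b) -> P_j)] for [-a < j <= 0]; so [d^b] into
  [P_j] is epi for [-a < j < 0], and [X] is the cokernel of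
  [d^b : P_(-b) -> P_0].  If [d^m : P_(-m) -> P_0] vanishes with
  [b < m < a + b], then cancelling the epi [d^b : P_(-m) -> P_(-m+b)] shows
  that [d^(m-b) : P_(-m+b) -> P_0] vanishes.  Starting from [m = a+b-1] and
  descending until [m <= b] gives [d^b = 0] into [P_0], so [X] is isomorphic to
  the projective object [P_0]. *)

Set Implicit Arguments.
Unset Strict Implicit.
Unset Printing Implicit Defensive.
Import GRing.Theory.
(* The vector library shadows [hom]. *)
Import Defs.
Local Open Scope ring_scope.
Local Open Scope cat_scope.

Section PreadditiveFacts.
Variable A : preadditiveCat.
Implicit Types X Y Z : A.

Lemma is_zero_idm X : idm X = 0 -> is_zero X.
Proof.
move=> X0; split=> T f; first by rewrite -[f]compm1 X0 compm0.
by rewrite -[f]comp1m X0 comp0m.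
Qed.

Lemma epi0P X Y (f : hom X Y) :
  (forall (T : A) (w : hom Y T), w ∘ f = 0 -> w = 0) -> epi f.
Proof.
move=> f0 T u v uv; apply/(addIr (- v)); rewrite subrr; apply: f0.
by rewrite compDl uv -compDl subrr comp0m.
Qed.

Lemma epi_cancel0 X Y Z (f : hom X Y) (w : hom Y Z) :
  epi f -> w ∘ f = 0 -> w = 0.
Proof. by move=> ef wf; apply: ef; rewrite wf comp0m. Qed.

Lemma iso_inv X Y (f : hom X Y) : iso f -> exists g : hom Y X, iso g.
Proof. by move=> [g [gf fg]]; exists g, f. Qed.

Lemma iso_comp X Y Z (g : hom Y Z) (f : hom X Y) : iso g -> iso f -> iso (g ∘ f).
Proof.
move=> [g' [g'g gg']] [f' [f'f ff']]; exists (f' ∘ g'); split.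
  by rewrite compA -[f' ∘ g' ∘ g]compA g'g compm1.
by rewrite compA -[g ∘ f ∘ f']compA ff' compm1.
Qed.

Lemma iso_zero X Y (f : hom X Y) : iso f -> is_zero Y -> is_zero X.
Proof.
move=> [g [gf _]] [_ Y0]; apply: is_zero_idm.
by rewrite -gf (Y0 _ f) compm0.
Qed.

Lemma iso_projective X Y (f : hom X Y) : iso f -> projective X -> projective Y.
Proof.
move=> [g [_ fg]] pX M N e ee h; have [k ek] := pX _ _ e ee (h ∘ f).
by exists (k ∘ g); rewrite compA ek -compA fg compm1.
Qed.

(** The identity of [X] factors through [k]; uniqueness of factorizations makes this section a
    two-sided inverse. *)
Lemma kernel0_iso X Y K (k : hom K X) : is_kernel (0 : hom X Y) k -> iso k.
Proof.
move=> [_ kP]; have [g [kg _]] := kP _ (idm X) (comp0m _ _).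
exists g; split=> //; have [u [_ uu]] := kP _ k (comp0m _ _).
rewrite -(uu (idm K)) ?compm1 // -(uu (g ∘ k)) //.
by rewrite compA kg comp1m.
Qed.

Lemma cokernel0_iso X Y Q (q : hom Y Q) : is_cokernel (0 : hom X Y) q -> iso q.
Proof.
move=> [_ qP]; have [g [gq _]] := qP _ (idm Y) (compm0 _ _).
exists g; split=> //; have [u [_ uu]] := qP _ q (compm0 _ _).
rewrite -(uu (idm Q)) ?comp1m // -(uu (q ∘ g)) //.
by rewrite -compA gq compm1.
Qed.

End PreadditiveFacts.

Section HomologyFacts.
Variable A : abelianCat.
Variables (X Y Z : A) (f : hom X Y) (g : hom Y Z) (gf : g ∘ f = 0).

Lemma hob_zero : is_zero Y -> is_zero (hob gf).
Proof.
move=> [_ Y0].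
have K0 (T : A) (t : hom T (kob g)) : t = 0.
  by apply: (@ker_mono _ _ _ g); rewrite (Y0 _ (ker g ∘ t)) compm0.
apply: is_zero_idm; apply: (@coker_epi _ _ _ (im_ker gf)).
by rewrite -[coker _]compm1 (K0 _ (idm _)) !compm0.
Qed.

(** Here [ker g] is invertible, so a map [w] killing [f] factors, up to that isomorphism, through
    the zero object [hob gf]. *)
Lemma hob_zero_epi : g = 0 -> is_zero (hob gf) -> epi f.
Proof.
move=> g0 [H0 _]; apply: epi0P => T w wf.
have [h [_ kh]] : iso (ker g).
  by have := kerP g; move: (ker g); rewrite g0 => k /kernel0_iso.
have wk : w ∘ ker g ∘ im_ker gf = 0.
  by rewrite -compA (ker_liftK (comp_im gf)) comp_im.
rewrite -[w]compm1 -kh compA -(coker_descK wk).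
by rewrite (H0 _ (coker_desc wk)) !comp0m.
Qed.

Lemma hob_iso : f = 0 -> g = 0 -> exists u : hom (hob gf) Y, iso u.
Proof.
move=> f0 g0.
have isok : iso (ker g).
  by have := kerP g; move: (ker g); rewrite g0 => k /kernel0_iso.
have im0 : im f = 0.
  (* As [f] is zero, even the identity of [Y] kills it, hence also kills [im f]. *)
  have idf : idm Y ∘ f = 0 by rewrite f0 compm0.
  by rewrite -[im f]comp1m (comp_im idf).
have i0 : im_ker gf = 0.
  by apply: ker_mono; rewrite (ker_liftK (comp_im gf)) im0 compm0.
have isoq : iso (coker (im_ker gf)).
  by have := cokerP (im_ker gf); move: (coker _); rewrite i0 => q /cokernel0_iso.
have [v isov] := iso_inv isoq.
by exists (ker g ∘ v); apply: iso_comp.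
Qed.

End HomologyFacts.

Section Complexes.
Variable A : abelianCat.
Implicit Types C : zseq A.

Lemma castc_eq0 (C : int -> A) (X : A) (i j : int) (e : i = j)
  (f : hom X (C i)) : castc e f = 0 -> f = 0.
Proof. by case: j / e. Qed.

(** The equation [i + n = 0] stays a hypothesis, so that no transport to [C 0] is needed. *)
Definition dpow_into0_zero C (n : nat) : Prop :=
  forall i : int, i + n%:Z = 0 -> dpow C n i = 0.

Lemma dpow_into0_zero_mono C (m n : nat) : (m <= n)%N ->
  dpow_into0_zero C m -> dpow_into0_zero C n.
Proof.
move=> /subnKC <- Cm i i0.
have e' : i + (m + (n - m))%N%:Z = i + (n - m)%N%:Z + m%:Z by lia.
(* The transport is inserted so that [dpow_add] can split off the last [m] differentials. *)
apply: (castc_eq0 (e := e')); rewrite -(dpow_add C erefl).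
by rewrite Cm ?comp0m //; lia.
Qed.

Lemma dpow_into0_zero_cancel C (b n : nat) :
  epi (dpow_to C b (- n%:Z)) ->
  dpow_into0_zero C (n + b) -> dpow_into0_zero C n.
Proof.
move=> eb Cnb i i0; have -> : i = - n%:Z by lia.
apply: (epi_cancel0 eb).
have e' : - n%:Z - b%:Z + (n + b)%N%:Z = - n%:Z + n%:Z by lia.
by rewrite /dpow_to (dpow_add C _ e') Cnb ?castc0 //; lia.
Qed.

(** If [b < m < a + b], then [0 < m - b < a], so the epi needed to pass from [m] to [m - b] is
    available. *)
Lemma dpow_into0_zero_descent C (a b : nat) :
  (0 < b)%N ->
  (forall n : nat, (0 < n < a)%N -> epi (dpow_to C b (- n%:Z))) ->
  forall m, (m < a + b)%N -> dpow_into0_zero C m -> dpow_into0_zero C b.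
Proof.
move=> b_gt0 eb; elim/ltn_ind => m IHm m_lt Cm.
have [mb|bm] := leqP m b; first exact: dpow_into0_zero_mono Cm.
apply: (IHm (m - b)%N); [lia | lia |].
by apply: dpow_into0_zero_cancel; [apply: eb; lia | rewrite subnK // ltnW].
Qed.

Lemma stalk_homology_zero (a b : nat) (N_gt0 : (0 < a + b)%N) (X : A) (j : int) :
  j != 0 -> is_zero (homology j (stalk N_gt0 X)).
Proof.
by move=> j0; apply: hob_zero; rewrite /= (negbTE j0); apply: zobP.
Qed.

Lemma stalk_homology0 (a b : nat) (N_gt0 : (0 < a + b)%N) (X : A) :
  (0 < a)%N -> (0 < b)%N ->
  exists u : hom (homology 0 (stalk N_gt0 X)) X, iso u.
Proof.
(* [stalk_subproof] at the exponents [a] and [b] makes both maps around degree 0 vanish. *)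
move=> a_gt0 b_gt0; apply: hob_iso; last exact: (stalk_subproof X a_gt0).
by rewrite /dpow_to (stalk_subproof X b_gt0) castc0.
Qed.

End Complexes.

Theorem theorem14 (A : abelianCat) (a b : nat) (a_gt0 : (0 < a)%N)
  (b_gt0 : (0 < b)%N) (X : A) (X_nproj : ~ projective X)
  (P : Ncomplex A (a + b)%N) (P_res : H_projective_resolution a_gt0 X P) :
  ~ is_Ncomplex (a + b - 1)%N P.
Proof.
move=> Pab1; apply: X_nproj; case: P_res => P_pos P_proj [f f_qi].
have da0 (j : int) : 1 <= j + a%:Z -> dpow P a j = 0.
  by move=> /P_pos [_ Pja0]; apply: Pja0.
have eb (n : nat) : (0 < n < a)%N -> epi (dpow_to P b (- n%:Z)).
  move=> n_a; apply: (hob_zero_epi (gf := dpow_zero P _)).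
    (* [d^a] from degree [-n] lands in degree [a - n], which is at least 1. *)
    by apply: da0; lia.
  by apply: (iso_zero (f_qi _)); apply: stalk_homology_zero; lia.
have db0 : dpow_into0_zero P b.
  apply: (dpow_into0_zero_descent b_gt0 eb (m := (a + b - 1)%N)); first by lia.
  by move=> i _; apply: Pab1.
have [u isou] : exists u : hom (homology 0 P) (P 0), iso u.
  apply: hob_iso; last by apply: da0; lia.
  by rewrite /dpow_to db0 ?castc0 //; lia.
have [v isov] := iso_inv isou.
have [w isow] := stalk_homology0 (ltn_addr b a_gt0) X a_gt0 b_gt0.
(* Projectivity is carried along [P 0], [H_0(P)], [H_0] of the stalk complex, [X]. *)
apply: (iso_projective (iso_comp isow (iso_comp (f_qi 0) isov))).
exact: P_proj.
Qed.
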